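(* Let $X,Y$ be real Banach spaces, let $A=(A_{n,k}:n,k\in\omega)$ be a matrix of linear operators in $\mathcal{L}(X,Y)$, and let $\mathcal{J}$ be a strongly selective ideal on $\omega$. Then $A\in(\ell_\infty(X),\ell_\infty(Y,\mathcal{J}))$ if and only if there exists $k_0\in\omega$ such that: (T1$^\flat$) there exists $J_0\in\mathcal{J}^\star$ for which $\sup_{n\in J_0}\|A_{n,\ge k_0}\|<\infty$ and, for all $n\in\omega\setminus J_0$, there exists $f(n)\in\omega$ such that $\|A_{n,\ge f(n)}\|<\infty$; (T2$^\flat$) $\mathcal{J}\text{-}\limsup_n\|A_{n,k}x\|<\infty$ for all $x\in X$ and $k<k_0$; (T3$^\natural$) $\lim_k\|A_{n,\ge k}\|=0$ for all $n\in\omega$. In addition, if each $A_{n,k}$ is bounded, it is possible to choose $k_0=0$.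
   Context: $\omega$ is the set of nonnegative integers. An ideal on $\omega$ is a family of subsets of $\omega$ closed under subsets and finite unions; every ideal is assumed to contain all finite sets and to differ from the power set of $\omega$. $\mathcal{J}^\star=\{S\subseteq\omega:\omega\setminus S\in\mathcal{J}\}$, $\mathcal{J}^+=\{S\subseteq\omega:S\notin\mathcal{J}\}$. An ideal $\mathcal{J}$ is strongly selective if for every decreasing sequence $(S_n)$ in $\mathcal{J}^+$ there is $S=\{x_n:n\in\omega\}\in\mathcal{J}^+$ (with $(x_n)$ the increasing enumeration of $S$) such that $x_{n+1}\in S_{x_n}$ for all $n\in\omega$. For a nonnegative sequence $(y_n)$, $\mathcal{J}\text{-}\limsup_ny_n=\inf\{r\in\mathbf{R}\cup\{\infty\}:\{n:y_n\ge r\}\in\mathcal{J}\}$. For a Banach space $V$, $\ell_\infty(V)$ is the space of norm-bounded sequences in $V$ and $\ell_\infty(V,\mathcal{J})=\{\boldsymbol{x}\in V^\omega:\mathcal{J}\text{-}\limsup_n\|x_n\|<\infty\}$. $\mathcal{L}(X,Y)$ is the space of all (not necessarily bounded) linear operators $X\to Y$. For $E\subseteq\omega$, the group norm is $\|A_{n,E}\|=\sup\{\|\sum_{k\in F}A_{n,k}x_k\|:F\subseteq E\text{ finite},\ x_k\in X,\ \|x_k\|\le1\}\in[0,\infty]$; $A_{n,\ge k}=A_{n,\{k,k+1,\dots\}}$. $A\boldsymbol{x}=(A_n\boldsymbol{x})_n$, $A_n\boldsymbol{x}=\sum_kA_{n,k}x_k$, provided each series converges in norm. $A\in(\mathscr{A},\mathscr{B})$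 means that $A\boldsymbol{x}$ is well defined and in $\mathscr{B}$ for every $\boldsymbol{x}\in\mathscr{A}$. *)

(* Defs.v *)
From mathcomp Require Import all_boot all_order all_algebra.
From mathcomp Require Import finmap.
From mathcomp Require Import all_classical all_reals all_analysis.

Set Implicit Arguments.
Unset Strict Implicit.
Unset Printing Implicit Defensive.

Import Order.TTheory GRing.Theory Num.Theory.
Import numFieldNormedType.Exports.

Local Open Scope classical_set_scope.
Local Open Scope ring_scope.

Definition is_ideal (J : set (set nat)) : Prop :=
  [/\ forall S T : set nat, S `<=` T -> J T -> J S,
      forall S T : set nat, J S -> J T -> J (S `|` T),
      forall S : set nat, finite_set S -> J S
    & ~ J [set: nat]].

Definition dual_filter (J : set (set nat)) : set (set nat) :=
  [set S | J (~` S)].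

Definition positive_sets (J : set (set nat)) : set (set nat) :=
  [set S | ~ J S].

(* A strictly increasing [x] is the increasing enumeration of its range. *)
Definition strongly_selective (J : set (set nat)) : Prop :=
  forall S : nat -> set nat,
    (forall n, positive_sets J (S n)) ->
    (forall n, S n.+1 `<=` S n) ->
    exists x : nat -> nat,
      [/\ forall n, (x n < x n.+1)%N,
          positive_sets J (range x)
        & forall n, S (x n) (x n.+1)].

Definition ideal_limsup (R : realType) (J : set (set nat)) (y : nat -> R) :
    \bar R :=
  ereal_inf [set r : \bar R | r != -oo%E /\ J [set n | (r <= (y n)%:E)%E]].

Definition linfty (R : realType) (V : completeNormedModType R) :
    set (nat -> V) :=
  [set x : nat -> V | bounded_fun x].

Definition ideal_linfty (R : realType) (V : completeNormedModType R)
    (J : set (set nat)) : set (nat -> V) :=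
  [set x : nat -> V | (ideal_limsup J (fun n => `|x n|%R) < +oo)%E].

Section Matrices.
Variables (R : realType) (X Y : completeNormedModType R).

Definition bounded_operator (T : {linear X -> Y}) : Prop :=
  exists M : R, forall x : X, `|T x| <= M * `|x|.

Definition group_norm (a : nat -> {linear X -> Y}) (E : set nat) : \bar R :=
  ereal_sup [set z : \bar R | exists (F : {fset nat}) (x : nat -> X),
    [/\ [set` F] `<=` E, forall k, `|x k| <= 1
      & z = (`|\sum_(k <- F) a k (x k)|%R)%:E]].

Definition group_norm_tail (a : nat -> {linear X -> Y}) (k : nat) : \bar R :=
  group_norm a [set j | (k <= j)%N].

Definition row_series (a : nat -> {linear X -> Y}) (x : nat -> X) : nat -> Y :=
  series (fun k => a k (x k)).

Definition matrix_class (P : set (nat -> X)) (Q : set (nat -> Y))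
    (A : nat -> nat -> {linear X -> Y}) : Prop :=
  forall x : nat -> X, P x ->
    (forall n, cvgn (row_series (A n) x)) /\
    Q (fun n => limn (row_series (A n) x)).

Definition cond_T1 (J : set (set nat)) (A : nat -> nat -> {linear X -> Y})
    (k0 : nat) : Prop :=
  exists J0 : set nat,
    [/\ dual_filter J J0,
        (ereal_sup [set group_norm_tail (A n) k0 | n in J0] < +oo)%E
      & forall n, ~ J0 n -> exists fn : nat,
          (group_norm_tail (A n) fn < +oo)%E].

Definition cond_T2 (J : set (set nat)) (A : nat -> nat -> {linear X -> Y})
    (k0 : nat) : Prop :=
  forall (x : X) (k : nat), (k < k0)%N ->
    (ideal_limsup J (fun n => `|A n k x|%R) < +oo)%E.

Definition cond_T3 (A : nat -> nat -> {linear X -> Y}) : Prop :=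
  forall n, group_norm_tail (A n) k @[k --> \oo] --> 0%E.

End Matrices.

(* Main.v *)
Require Import Defs.
From mathcomp Require Import all_boot all_order all_algebra.
From mathcomp Require Import finmap.
From mathcomp Require Import all_classical all_reals all_analysis.
From mathcomp Require Import lra.

Set Implicit Arguments.
Unset Strict Implicit.
Unset Printing Implicit Defensive.

Import Order.TTheory GRing.Theory Num.Theory.
Import numFieldNormedType.Exports.

Local Open Scope classical_set_scope.
Local Open Scope ring_scope.

(** Everything rests on one gliding hump.  A row [a] sums every bounded
    sequence exactly when its tails [group_norm_tail a k] vanish: otherwise
    infinitely many disjoint finite blocks of [a] take values of norm larger
    than a fixed [e] on vectors of the unit ball, and gluing these vectors
    into one sequence ([glue_blocks]) gives a series that is not Cauchy
    ([group_norm_tail_cvg0]).  This is (T3).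

    For (T1), suppose that for all [k] and [M] the set of rows [n] with
    [M < group_norm_tail (A n) k] is positive.  Let [g m] be an index beyond
    which the rows [0, ..., m] have tails at most 1.  Strong selectivity,
    applied to the sets of those [n] with [m < group_norm_tail (A n) (g m)],
    returns rows [n_0 < n_1 < ...] with positive range such that row
    [n_(i+1)] has a hump larger than [n_i] beyond [g n_i]; by the choice of
    [g], all but 1 of it lies in the columns from [g n_i] to [g n_(i+1)].
    These column blocks are disjoint, so a single unit sequence [x] can be
    built block by block.  No bound on the operators is at hand to control
    what row [n_(i+1)] does to the blocks already chosen; instead the sign of
    the new block is chosen, since of [v + w] and [v - w] at least one has
    norm at least that of [w] ([gliding_hump]).  Then the norms of [A x] tend
    to infinity along a positive set, which is absurd ([T1_necessary]).

    (T2) comes from sequences with one nonzero entry, and sufficiency from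
    splitting each row at column [k0].

    If the operators are bounded, the first [k0] columns are absorbed one at a
    time by a Banach-Steinhaus theorem modulo the ideal
    ([ideal_uniform_boundedness]).  That theorem is an instance of what
    precedes: if bounded operators [T n] are pointwise bounded modulo the
    ideal, the matrix with entries [2^-m T n] maps bounded sequences to
    sequences bounded modulo the ideal, because its [n]-th row sends [x] to
    [T n] of the vector [sum_m 2^-m x_m]; (T1) for this matrix bounds a fixed
    multiple of the norm of [T n] for all [n] off a set of the ideal. *)

(** * Tails of a row of operators *)

Section GroupNorm.
Variables (R : realType) (X Y : completeNormedModType R).
Implicit Types (a : nat -> {linear X -> Y}) (x : nat -> X).

(** Padding by zero turns the sums over arbitrary finite sets that define the
    group norm into sums over intervals, that is, into differences of partial
    sums of the series. *)
Lemma fset_sum_padded a (F : {fset nat}) x k l :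
    [set` F] `<=` [set j | (k <= j < l)%N] ->
  \sum_(k <= j < l) a j (if j \in F then x j else 0) = \sum_(j <- F) a j (x j).
Proof.
move=> Fkl; transitivity (\sum_(k <= j < l | j \in F) a j (x j)).
  by rewrite [RHS]big_mkcond; apply: eq_bigr => j _; case: ifP; rewrite ?linear0.
rewrite -big_filter; apply: perm_big; apply: uniq_perm; rewrite ?fset_uniq//.
  by rewrite filter_uniq// iota_uniq.
move=> j; rewrite mem_filter mem_index_iota.
by have [jF|//] := boolP (j \in F); have /= -> := Fkl j jF.
Qed.

(** The witness is a hump of the row.  Being padded by zero, it keeps its norm
    on every longer interval, so the right end point may be chosen later. *)
Lemma lt_group_norm_tail a k (r : R) : (r%:E < group_norm_tail a k)%E ->
  exists l x, (forall j, `|x j| <= 1) /\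
    forall m, (l <= m)%N -> r < `|\sum_(k <= j < m) a j (x j)|.
Proof.
move=> /ereal_sup_gt[_ [F [x [Fk x1 ->]]]]; rewrite lte_fin => rF.
exists (\max_(j <- F) j).+1, (fun j => if j \in F then x j else 0).
split=> [j|m lm]; first by case: ifP; rewrite ?normr0.
rewrite fset_sum_padded// => j jF /=; rewrite (Fk j jF)/=.
by apply: leq_trans lm; rewrite ltnS; apply: (@leq_bigmax_seq _ _ xpredT id).
Qed.

Lemma group_norm_tail_leP a k (r : R) : (group_norm_tail a k <= r%:E)%E <->
  forall l x, (forall j, `|x j| <= 1) -> `|\sum_(k <= j < l) a j (x j)| <= r.
Proof.
split=> [akr l x x1|h].
  rewrite -lee_fin; apply: le_trans akr; apply: ereal_sup_ubound.
  exists [fset j in index_iota k l]%fset, x; split=> //.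
    by move=> j /=; rewrite !inE mem_index_iota => /andP[].
  rewrite -(@fset_sum_padded _ _ _ k l); last first.
    by move=> j /=; rewrite !inE mem_index_iota.
  by congr (`|_|%:E); apply: eq_big_nat => j jkl; rewrite !inE mem_index_iota jkl.
rewrite leNgt; apply/negP => /lt_group_norm_tail[l [x [x1 /(_ l (leqnn l))]]].
by rewrite ltNge h.
Qed.

Lemma group_norm_tail_ge0 a k : (0 <= group_norm_tail a k)%E.
Proof.
apply: ereal_sup_ubound; exists fset0, (fun=> 0); split=> [j|j|].
- by rewrite /= inE.
- by rewrite normr0.
- by rewrite big_seq_fset0 normr0.
Qed.

Lemma group_norm_tail_nonincreasing a :
  {homo group_norm_tail a : k l / (k <= l)%N >-> (l <= k)%E}.
Proof.
move=> k l kl; apply: ereal_sup_le => _ [F [x [Fl x1 ->]]].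
by exists F, x; split=> // j /Fl; exact: leq_trans.
Qed.

(** The tails decrease in [k], so one small tail suffices. *)
Lemma cvg_group_norm_tail0P a : group_norm_tail a k @[k --> \oo] --> 0%E <->
  forall e : R, 0 < e -> exists k, (group_norm_tail a k <= e%:E)%E.
Proof.
have acvg := ereal_nonincreasing_cvgn (@group_norm_tail_nonincreasing a).
split=> [a0 e e0|h].
  have inf0 := cvg_unique (@ereal_hausdorff R) acvg a0.
  have /ereal_inf_lt[_ [k _ <-] /ltW ke] :
      (ereal_inf (range (group_norm_tail a)) < e%:E)%E by rewrite inf0 lte_fin.
  by exists k.
suff <- : ereal_inf (range (group_norm_tail a)) = 0%E by [].
apply/eqP; rewrite eq_le; apply/andP; split; last first.
  by apply: le_ereal_inf_tmp => _ [k _ <-]; exact: group_norm_tail_ge0.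
apply/lee_addgt0Pr => e /h[k ke]; rewrite add0e.
by apply: ge_ereal_inf; exists (group_norm_tail a k) => //; exists k.
Qed.

Lemma block_sum_le a k l x (r C : R) : 0 < C -> (forall j, `|x j| <= C) ->
  (group_norm_tail a k <= r%:E)%E -> `|\sum_(k <= j < l) a j (x j)| <= C * r.
Proof.
move=> C0 xC /group_norm_tail_leP/(_ l (fun j => C^-1 *: x j)) h.
rewrite mulrC -ler_pdivrMr//.
under eq_bigr do rewrite -[x _](scalerKV (lt0r_neq0 C0)) linearZ.
rewrite -scaler_sumr normrZ gtr0_norm// mulrC mulKf ?lt0r_neq0//.
by apply: h => j; rewrite normrZ gtr0_norm ?invr_gt0// mulrC ler_pdivrMr ?mul1r.
Qed.

End GroupNorm.

(** * Gluing blocks *)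

(** The recursive construction behind both gliding humps.  A stage may look at
    the whole sequence built so far but keeps its entries below [k i]; as
    entries below [k i.+1] are never changed after stage [i], the diagonal
    sequence agrees with stage [i] wherever [P i] looks. *)
Lemma glue_blocks (T : Type) (D : T -> Prop) (P : nat -> (nat -> T) -> Prop)
    (k : nat -> nat) :
  inhabited {t | D t} -> {homo k : i j / (i < j)%N} ->
  (forall i x y, (forall j, (j < k i.+1)%N -> x j = y j) -> P i x -> P i y) ->
  (forall i x, (forall j, D (x j)) -> exists y,
    [/\ forall j, D (y j), forall j, (j < k i)%N -> y j = x j & P i y]) ->
  exists x, (forall j, D (x j)) /\ forall i, P i x.
Proof.
move=> [[t0 Dt0]] kmono Ploc extend.
have kW := ltnW_homo kmono.
(* entry [j] is settled at stage [j.+1] because [j < k j.+1] *)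
have ge_k i : (i <= k i)%N.
  by elim: i => // i /leq_ltn_trans; apply; exact: kmono.
pose DT := {x : nat -> T | forall j, D (x j)}.
have extend' (ix : nat * DT) : exists y : DT,
    (forall j, (j < k ix.1)%N -> sval y j = sval ix.2 j) /\ P ix.1 (sval y).
  case: ix => i [x Dx] /=; have [y [Dy yx Py]] := extend i x Dx.
  by exists (exist _ y Dy).
have [step stepP] := choice extend'.
pose x0 : DT :=
  exist (fun x : nat -> T => forall j, D (x j)) (fun=> t0) (fun=> Dt0).
pose x_ := fix x_ i : DT :=
  if i is i'.+1 then step (i', x_ i') else x0.
have x_stable i m j : (i <= m)%N -> (j < k i)%N -> sval (x_ m) j = sval (x_ i) j.
  elim: m => [|m IH]; first by rewrite leqn0 => /eqP->.
  rewrite leq_eqVlt => /orP[/eqP->//|]; rewrite ltnS => im jk.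
  rewrite -IH//; have [+ _] := stepP (m, x_ m); apply.
  exact: leq_trans jk (kW _ _ im).
exists (fun j => sval (x_ j.+1) j); split=> [j|i]; first exact: (svalP (x_ j.+1) j).
apply: Ploc (stepP (i, x_ i)).2 => j jk.
have jkj : (j < k j.+1)%N by exact: ge_k.
have [ij|ji] := leqP i.+1 j.+1; first by rewrite (@x_stable i.+1 j.+1).
by rewrite -(@x_stable j.+1 i.+1)// ltnW.
Qed.

(** * Boundedness modulo an ideal and limits of rows *)

Lemma ideal_limsup_lty (R : realType) (J : set (set nat)) (y : nat -> R) :
  (ideal_limsup J y < +oo)%E <-> exists M : R, J [set n | M <= y n].
Proof.
split=> [/ereal_inf_lt[[r| |] [rN Jr]]//|[M JM]]; first by exists r.
apply: (@le_lt_trans _ _ M%:E); last exact: ltry.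
by apply: ereal_inf_lbound; split.
Qed.

Lemma linfty_bound (R : realType) (X : completeNormedModType R) (x : nat -> X) :
  linfty x <-> exists2 C, 0 < C & forall n, `|x n| <= C.
Proof.
split=> [/pinfty_ex_gt0[C C0 xC]|[C _ xC]]; first by exists C => // n; exact: xC.
by exists C; split; rewrite ?num_real// => D CD n _; apply: le_trans (xC n) (ltW CD).
Qed.

Lemma lim_dist_le (R : realType) (V : normedModType R) (u : nat -> V) k
    (M : R) :
  cvgn u -> (forall l, (k <= l)%N -> `|u l - u k| <= M) ->
  `|limn u - u k| <= M.
Proof.
move=> cu uM; have cN : `|u l - u k| @[l --> \oo] --> `|limn u - u k|.
  by apply: cvg_norm; apply: cvgB => //; exact: cvg_cst.
by apply: (cvgr_to_le cN); exists k.
Qed.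

Section Rows.
Variables (R : realType) (X Y : completeNormedModType R).
Implicit Types (a : nat -> {linear X -> Y}) (x : nat -> X).

Lemma row_series_cvg a x : linfty x ->
  group_norm_tail a k @[k --> \oo] --> 0%E -> cvgn (row_series a x).
Proof.
move=> /linfty_bound[C C0 xC] /cvg_group_norm_tail0P a0.
apply/cauchy_cvgP/cauchy_seriesP => e e0.
have [k ake] := a0 (e / 2 / C) ltac:(by rewrite !divr_gt0).
exists ([set m | (k <= m)%N], [set m | (k <= m)%N]) => [|[m n]/= [km kn]].
  by split; exists k.
have := block_sum_le n C0 xC (le_trans (group_norm_tail_nonincreasing a km) ake).
by rewrite mulrC divfK ?lt0r_neq0//; lra.
Qed.

Lemma row_lim_tail_le a x k (r C : R) : 0 < C -> (forall j, `|x j| <= C) ->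
  cvgn (row_series a x) -> (group_norm_tail a k <= r%:E)%E ->
  `|limn (row_series a x) - \sum_(0 <= j < k) a j (x j)| <= C * r.
Proof.
move=> C0 xC cx akr; apply: (lim_dist_le (k := k)) => // l kl.
by rewrite sub_series_geq//; exact: block_sum_le.
Qed.

(** If some [e] stays below all the tails, the blocks [k_ i <= j < k_ i.+1] can
    be chosen each to carry a hump larger than [e]; glued together, these humps
    violate the Cauchy criterion. *)
Lemma group_norm_tail_cvg0 a : (forall x, linfty x -> cvgn (row_series a x)) ->
  group_norm_tail a k @[k --> \oo] --> 0%E.
Proof.
move=> acvg; apply/cvg_group_norm_tail0P; apply: contrapT.
move=> /existsNP[e /not_implyP[e0 /forallNP ae]].
have /choice[l /choice[u luP]] k : exists l x, (forall j, `|x j| <= 1) /\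
    forall m, (l <= m)%N -> e < `|\sum_(k <= j < m) a j (x j)|.
  by apply: lt_group_norm_tail; rewrite ltNge; apply/negP/ae.
pose k_ i := iter i (fun k => maxn (l k) k.+1) 0%N.
have k_incr : {homo k_ : i j / (i < j)%N}.
  by apply: homo_ltn => [|i]; [exact: ltn_trans|rewrite /k_/= leq_max leqnn orbT].
pose P i x := e < `|\sum_(k_ i <= j < k_ i.+1) a j (x j)|.
have [|i x y xy|i x x1|x [x1 xP]] :=
    @glue_blocks X (fun t => `|t| <= 1) P k_ _ k_incr.
- by constructor; exists 0; rewrite normr0.
- by rewrite /P; under eq_big_nat => j /andP[_ /xy ->] do over.
- have [u1 ue] := luP (k_ i).
  exists (fun j => if (j < k_ i)%N then x j else u (k_ i) j); split.
  + by move=> j; case: ifP.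
  + by move=> j ->.
  rewrite /P; under eq_big_nat => j /andP[kj _] do rewrite ltnNge kj/=.
  by apply: ue; rewrite leq_max leqnn.
have /acvg/cauchy_cvgP/cauchy_seriesP/(_ e e0) : linfty x.
  by apply/linfty_bound; exists 1.
case=> -[/= U V] [[M _ MU] [N _ NV]] UV.
have le_k i : (i <= k_ i)%N by elim: i => // i /leq_ltn_trans; apply; exact: k_incr.
pose m := maxn M N.
have Um : U (k_ m) by apply: MU => /=; apply: leq_trans (le_k _); exact: leq_maxl.
have Vm : V (k_ m.+1).
  apply: NV => /=; apply: leq_trans (ltnW (k_incr _ _ (ltnSn m))).
  by apply: leq_trans (le_k _); exact: leq_maxr.
have /lt_trans/(_ (xP m)) := UV (k_ m, k_ m.+1) (conj Um Vm).
by rewrite ltxx.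
Qed.

End Rows.

(** * Ideals and the three conditions *)

Lemma ideal_subset (J : set (set nat)) (hJ : is_ideal J) (S T : set nat) :
  S `<=` T -> J T -> J S.
Proof. by case: hJ => + _ _ _; apply. Qed.

Lemma ideal_setU (J : set (set nat)) (hJ : is_ideal J) (S T : set nat) :
  J S -> J T -> J (S `|` T).
Proof. by case: hJ => _ + _ _; apply. Qed.

Lemma ideal_finite (J : set (set nat)) (hJ : is_ideal J) (S : set nat) :
  finite_set S -> J S.
Proof. by case: hJ => _ _ + _; apply. Qed.

Section Matrices.
Variables (R : realType) (X Y : completeNormedModType R) (J : set (set nat)).
Hypothesis hJ : is_ideal J.
Implicit Types A : nat -> nat -> {linear X -> Y}.

(** Under (T3) every row has a finite tail, so only the uniform bound off a set
    of the ideal is left of (T1). *)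
Lemma cond_T1P A k0 : cond_T3 A -> cond_T1 J A k0 <->
  exists M : R, J [set n | (M%:E < group_norm_tail (A n) k0)%E].
Proof.
move=> AT3; split=> [[J0 [JJ0 supJ0 _]]|[M JM]].
  exists (fine (ereal_sup [set group_norm_tail (A n) k0 | n in J0])).
  apply: (ideal_subset hJ) JJ0 => n /= + J0n; apply/negP; rewrite -leNgt.
  have nsup : (group_norm_tail (A n) k0 <=
      ereal_sup [set group_norm_tail (A n) k0 | n in J0])%E.
    by apply: ereal_sup_ubound; exists n.
  rewrite fineK// ge0_fin_numE//.
  exact: le_trans (group_norm_tail_ge0 _ _) nsup.
exists (~` [set n | (M%:E < group_norm_tail (A n) k0)%E]); split.
- by rewrite /dual_filter/= setCK.
- apply: (@le_lt_trans _ _ M%:E); last exact: ltry.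
  by apply: ge_ereal_sup => _ [n /negP + <-]; rewrite -leNgt.
- move=> n _; have /cvg_group_norm_tail0P/(_ 1 ltr01)[k k1] := AT3 n.
  by exists k; apply: le_lt_trans k1 (ltry _).
Qed.

Lemma T3_necessary A (Q : set (nat -> Y)) :
  matrix_class (@linfty R X) Q A -> cond_T3 A.
Proof. by move=> AQ n; apply: group_norm_tail_cvg0 => x /AQ[]. Qed.

Lemma T2_necessary A k0 :
  matrix_class (@linfty R X) (@ideal_linfty R Y J) A -> cond_T2 J A k0.
Proof.
move=> AQ x k _; pose xk j := if j == k then x else 0.
have [|_] := AQ xk.
  apply/linfty_bound; exists (`|x| + 1); first exact: ltr_wpDl.
  by move=> j; rewrite /xk; case: ifP; rewrite ?normr0; have := normr_ge0 x; lra.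
rewrite /ideal_linfty/=; congr (_ < _)%E; congr ideal_limsup.
apply/funext => n; congr `|_|; apply: cvg_lim => //.
apply: cvg_near_cst; exists k.+1 => // m /= km; apply/eqP.
rewrite /row_series /series/= (bigD1_seq k)/= ?iota_uniq ?mem_index_iota//.
rewrite big1 ?addr0 /xk ?eqxx// => j /negPf->; exact: linear0.
Qed.

(** Columns below [k0] are bounded modulo the ideal one by one by (T2); the rest
    of row [n] is uniformly bounded by (T1). *)
Lemma matrix_class_sufficient A k0 :
  cond_T1 J A k0 -> cond_T2 J A k0 -> cond_T3 A ->
  matrix_class (@linfty R X) (@ideal_linfty R Y J) A.
Proof.
move=> AT1 AT2 AT3 x xb; split=> [n|]; first exact: row_series_cvg.
have [M JM] := (cond_T1P k0 AT3).1 AT1; have [C C0 xC] := (linfty_bound x).1 xb.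
apply/ideal_limsup_lty.
have [N JN] : exists N : R,
    J [set n | N <= \sum_(0 <= k < k0) `|A n k (x k)|].
  suff: forall k, (k <= k0)%N -> exists N : R,
    J [set n | N <= \sum_(0 <= j < k) `|A n j (x j)|] by apply.
  elim=> [_|k IH kk0].
    exists 1; apply: (ideal_subset hJ (T := set0)).
      by move=> n /=; rewrite big_geq// ler10.
    exact/(ideal_finite hJ)/finite_set0.
  have [N JN] := IH (ltnW kk0).
  have /ideal_limsup_lty[N' JN'] := AT2 (x k) k kk0.
  exists (N + N'); apply: (ideal_subset hJ) (ideal_setU hJ JN JN') => n /=.
  rewrite big_nat_recr//=; case: (leP N) => [|h]; first by left.
  by case: (leP N') => [|h']; [right|lra].
exists (N + C * M); apply: (ideal_subset hJ) (ideal_setU hJ JM JN) => n /=.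
case: (leP N) => [|h]; first by right.
case: ltP => [|h']; first by left.
have := row_lim_tail_le C0 xC (row_series_cvg xb (AT3 n)) h'.
have := ler_norm_sum (index_iota 0 k0) (fun k => A n k (x k)) xpredT.
set s := \sum_(_ <- _) _ in h *; set l := limn _ => sle lle Nle.
have := ler_normD s (l - s); rewrite addrC subrK.
lra.
Qed.

End Matrices.

(** * Necessity of the uniform bound *)

Section Necessity.
Variables (R : realType) (X Y : completeNormedModType R) (J : set (set nat)).
Hypotheses (hJ : is_ideal J) (hsel : strongly_selective J).

(** The rows [n_ i.+1] have humps larger than [n_ i] beyond column [k_ i] and
    tails at most 1 beyond column [k_ i.+1].  One unit sequence makes all these
    rows large at once, because the sign of each new block is free: it is
    chosen so that the block does not cancel against the earlier ones. *)
Lemma gliding_hump (A : nat -> nat -> {linear X -> Y}) (n_ k_ : nat -> nat) :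
  {homo k_ : i j / (i < j)%N} ->
  (forall i, (group_norm_tail (A (n_ i.+1)) (k_ i.+1) <= 1%:E)%E) ->
  (forall i, ((n_ i)%:R%:E < group_norm_tail (A (n_ i.+1)) (k_ i))%E) ->
  exists x, (forall j, `|x j| <= 1) /\ forall i,
    (n_ i)%:R - 1 <= `|\sum_(0 <= j < k_ i.+1) A (n_ i.+1) j (x j)|.
Proof.
move=> k_incr A_small A_large.
apply: (@glue_blocks X (fun t => `|t| <= 1) (fun i x => (n_ i)%:R - 1 <=
  `|\sum_(0 <= j < k_ i.+1) A (n_ i.+1) j (x j)|) _ _ k_incr).
- by constructor; exists 0; rewrite normr0.
- by move=> i x y xy; under eq_big_nat => j /andP[_ /xy ->] do over.
move=> i x x1; have [l [u [u1 nu]]] := lt_group_norm_tail (A_large i).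
have kk : (k_ i <= k_ i.+1)%N by exact/ltnW/k_incr.
(* cutting the hump at [k_ i.+1] costs at most the tail, that is 1 *)
have u_block : (n_ i)%:R - 1 <=
    `|\sum_(k_ i <= j < k_ i.+1) A (n_ i.+1) j (u j)|.
  have := nu (maxn l (k_ i.+1)) (leq_maxl _ _).
  rewrite (@big_cat_nat _ _ _ (k_ i.+1))/= ?leq_maxr// => nD.
  have := (group_norm_tail_leP _ _ _).1 (A_small i) (maxn l (k_ i.+1)) u u1.
  by have := ler_normD (\sum_(k_ i <= j < k_ i.+1) A (n_ i.+1) j (u j))
    (\sum_(k_ i.+1 <= j < maxn l (k_ i.+1)) A (n_ i.+1) j (u j)); lra.
set w := \sum_(_ <= _ < _) _ in u_block.
pose v := \sum_(0 <= j < k_ i) A (n_ i.+1) j (x j).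
have patch (s : R) : `|s| = 1 -> (n_ i)%:R - 1 <= `|v + s *: w| -> exists y,
    [/\ forall j, `|y j| <= 1, forall j, (j < k_ i)%N -> y j = x j
      & (n_ i)%:R - 1 <= `|\sum_(0 <= j < k_ i.+1) A (n_ i.+1) j (y j)|].
  move=> s1 large; exists (fun j => if (j < k_ i)%N then x j else s *: u j).
  split=> [j|j ->//|].
    by case: ifP => // _; rewrite normrZ s1 mul1r.
  rewrite (@big_cat_nat _ _ _ (k_ i))//=.
  under [X in `|X + _|]eq_big_nat => j /andP[_ jk] do rewrite jk.
  under [X in `|_ + X|]eq_big_nat => j /andP[kj _] do rewrite ltnNge kj/= linearZ.
  by rewrite -scaler_sumr.
(* [2 w = (v + w) - (v - w)], so [1] or [-1] is a suitable sign *)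
have : 2 * `|w| <= `|v + w| + `|v - w|.
  have := ler_normB (v + w) (v - w).
  by rewrite opprB [X in X + _]addrC addrACA subrr addr0 -mulr2n normrMn mulr_natl.
case: (leP ((n_ i)%:R - 1) `|v + w|) => [+ _|vw h].
  by rewrite -{1}[w]scale1r; apply: patch; rewrite normr1.
apply: (patch (-1)); first by rewrite normrN1.
by rewrite scaleN1r; lra.
Qed.

(** The index [g m] is what makes strong selectivity applicable: it depends on
    [m] alone, so the sets [S m] are fixed before the rows are selected, yet
    [g (n_ i)] is beyond the significant part of row [n_ i]. *)
Lemma T1_necessary (A : nat -> nat -> {linear X -> Y}) :
  matrix_class (@linfty R X) (@ideal_linfty R Y J) A ->
  exists k0, cond_T1 J A k0.
Proof.
move=> AQ; have AT3 := T3_necessary AQ; apply: contrapT => noT1.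
have /choice[f f1] n : exists k, (group_norm_tail (A n) k <= 1%:E)%E.
  exact: (cvg_group_norm_tail0P _).1 (AT3 n) 1 ltr01.
pose g m := (\sum_(0 <= i < m.+1) (f i).+1)%N.
have g_incr : {homo g : m n / (m < n)%N}.
  apply: homo_ltn => [|m]; first exact: ltn_trans.
  by rewrite /g [ltnRHS]big_nat_recr//= addnS ltnS leq_addr.
have g1 n : (group_norm_tail (A n) (g n) <= 1%:E)%E.
  apply: le_trans (group_norm_tail_nonincreasing _ _) (f1 n).
  by rewrite /g big_nat_recr//= addnS; apply: leqW; exact: leq_addl.
pose S m := [set n | (m%:R%:E < group_norm_tail (A n) (g m))%E].
have [m|m n|n_ [n_incr n_pos n_S]] := hsel (S := S).
- by move=> JS; apply: noT1; exists (g m); apply/cond_T1P => //; exists m%:R.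
- rewrite /S/= => h; apply: (@lt_trans _ _ m.+1%:R%:E).
    by rewrite lte_fin ltr_nat.
  apply: lt_le_trans h (group_norm_tail_nonincreasing _ _).
  exact/ltnW/g_incr.
have n_homo : {homo n_ : i j / (i < j)%N}.
  by apply: homo_ltn => //; exact: ltn_trans.
have [x [x1 xP]] := @gliding_hump A n_ (g \o n_)
  (fun i j ij => g_incr _ _ (n_homo _ _ ij)) (fun i => g1 (n_ i.+1)) n_S.
have xb : linfty x by apply/linfty_bound; exists 1.
have [/(_ _) xcvg /ideal_limsup_lty[M JM]] := AQ x xb.
(* in row [n_ i.+1] the limit has norm at least [n_ i - 2], one more tail being
   lost in passing from the partial sum to the limit *)
apply: n_pos; pose K := (Num.truncn `|M + 2|).+1.
have JK := ideal_finite hJ (finite_image n_ (finite_II K.+1)).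
apply: (ideal_subset hJ) (ideal_setU hJ JM JK).
move=> _ [[|i] _ <-]; first by right; exists 0%N.
have [iK|Ki] := ltnP i.+1 K.+1; [by right; exists i.+1|left => /=].
have K_lt : M + 2 < K%:R.
  by apply: le_lt_trans (ler_norm _) _; exact: truncnS_gt.
have le_n : K%:R <= (n_ i)%:R :> R.
  rewrite ler_nat; apply: (@leq_trans i) => //.
  by elim: i {Ki} => // i IH; exact: leq_ltn_trans IH (n_homo _ _ (ltnSn i)).
have := row_lim_tail_le ltr01 x1 (xcvg (n_ i.+1)) (g1 (n_ i.+1)).
have := xP i => /=.
set l := limn _; set s := \sum_(_ <= _ < _) _ => n_le l_le.
have := ler_distD 0 s l; rewrite !subr0 sub0r normrN distrC => h.
have := ler_normB l (l - s); rewrite opprB addrC subrK.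
lra.
Qed.

End Necessity.

(** * Bounded operators *)

Section Bounded.
Variables (R : realType) (X Y : completeNormedModType R) (J : set (set nat)).
Hypotheses (hJ : is_ideal J) (hsel : strongly_selective J).

Lemma bounded_operator_continuous (T : {linear X -> Y}) :
  bounded_operator T -> continuous T.
Proof.
case=> M TM; apply/linear_bounded_continuous/bounded_funP => r.
exists (`|M| * r) => x xr; apply: le_trans (TM x) _.
by apply: le_trans (ler_wpM2l (normr_ge0 M) xr); rewrite ler_wpM2r// ler_norm.
Qed.

(** Banach-Steinhaus modulo the ideal, by applying the necessity of (T1) to the
    matrix with entries [2^-m T n].  The weights make its rows summable while
    keeping every entry a nonzero multiple of [T n], so the column from which
    (T1) holds, whichever it is, controls the norm of [T n]. *)
Lemma ideal_uniform_boundedness (T : nat -> {linear X -> Y}) :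
  (forall n, bounded_operator (T n)) ->
  (forall x, (ideal_limsup J (fun n => `|T n x|%R) < +oo)%E) ->
  exists C : R, J [set n | ~ forall x, `|x| <= 1 -> `|T n x| <= C].
Proof.
move=> Tb Tx; pose B n m : {linear X -> Y} := (2^-1 ^+ m) \*: T n.
have BQ : matrix_class (@linfty R X) (@ideal_linfty R Y J) B.
  move=> x /linfty_bound[C C0 xC].
  have cx : cvgn (series (fun m => 2^-1 ^+ m *: x m)).
    apply: normed_cvg; apply: (@series_le_cvg _ _ (geometric C 2^-1)) => [n|n|n|].
    - exact: normr_ge0.
    - by rewrite mulr_ge0 ?exprn_ge0// ltW.
    - by rewrite /= normrZ ger0_norm ?exprn_ge0// mulrC ler_wpM2r ?exprn_ge0.
    - by apply: is_cvg_geometric_series; rewrite ger0_norm//; lra.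
  have Bx n : row_series (B n) x @ \oo -->
      T n (limn (series (fun m => 2^-1 ^+ m *: x m))).
    suff -> : row_series (B n) x =
        (fun N => T n (series (fun m => 2^-1 ^+ m *: x m) N)).
      by apply: cvg_comp cx _; exact: bounded_operator_continuous.
    apply/funext => N; rewrite /row_series /series/= linear_sum.
    by apply: eq_bigr => m _; rewrite linearZ.
  split=> [n|]; first by apply/cvg_ex; eexists; exact: Bx.
  rewrite /ideal_linfty/=.
  under eq_fun do rewrite (cvg_lim _ (Bx _))//.
  exact: Tx.
have [k0 /(cond_T1P hJ k0 (T3_necessary BQ))[M JM]] := T1_necessary hJ hsel BQ.
exists (2 ^+ k0 * M); apply: (ideal_subset hJ) JM => n /=.
apply: contra_notP => /negP; rewrite -leNgt => /group_norm_tail_leP h x x1.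
have := h k0.+1 (fun=> x) (fun=> x1).
by rewrite big_nat1/= normrZ ger0_norm ?exprn_ge0// exprVn ler_pdivrMl ?exprn_gt0.
Qed.

(** A column that is uniformly bounded off a set of the ideal can be added to
    the tail; iterating brings [k0] down to 0. *)
Lemma T1_lower_column (A : nat -> nat -> {linear X -> Y}) k :
  (forall n, bounded_operator (A n k)) -> cond_T3 A ->
  (forall x, (ideal_limsup J (fun n => `|A n k x|%R) < +oo)%E) ->
  cond_T1 J A k.+1 -> cond_T1 J A k.
Proof.
move=> Ab AT3 /(ideal_uniform_boundedness Ab)[C JC].
move=> /(cond_T1P hJ k.+1 AT3)[M JM]; apply/cond_T1P => //; exists (C + M).
apply: (ideal_subset hJ) (ideal_setU hJ JC JM) => n /= h.
apply: contrapT => /not_orP[/contrapT AC /negP].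
rewrite -leNgt => AM; move: h; apply/negP; rewrite -leNgt.
apply/group_norm_tail_leP => l x x1.
have Ax := AC _ (x1 k).
have AlM := (group_norm_tail_leP _ _ _).1 AM l x x1.
have [kl|lk] := ltnP k l.
  by rewrite big_ltn//; apply: le_trans (ler_normD _ _) _; exact: lerD.
rewrite big_geq// normr0 addr_ge0//; [exact: le_trans Ax|exact: le_trans AlM].
Qed.

End Bounded.

Theorem theorem3p8 (R : realType) (X Y : completeNormedModType R)
    (A : nat -> nat -> {linear X -> Y}) (J : set (set nat))
    (hJ : is_ideal J) (hsel : strongly_selective J) :
  (matrix_class (@linfty R X) (@ideal_linfty R Y J) A <->
    exists k0 : nat, [/\ cond_T1 J A k0, cond_T2 J A k0 & cond_T3 A]) /\
  ((forall n k, bounded_operator (A n k)) ->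
    (matrix_class (@linfty R X) (@ideal_linfty R Y J) A <->
      [/\ cond_T1 J A 0%N, cond_T2 J A 0%N & cond_T3 A])).
Proof.
have necessity : matrix_class (@linfty R X) (@ideal_linfty R Y J) A ->
    exists k0 : nat, [/\ cond_T1 J A k0, cond_T2 J A k0 & cond_T3 A].
  move=> AQ; have [k0 AT1] := T1_necessary hJ hsel AQ.
  by exists k0; split=> //; [exact: T2_necessary|exact: T3_necessary AQ].
split=> [|Ab].
  by split=> // -[k0 [? ? ?]]; exact: (@matrix_class_sufficient _ _ _ _ hJ _ k0).
split=> [AQ|[? ? ?]]; last exact: (@matrix_class_sufficient _ _ _ _ hJ _ 0%N).
have [k0 [AT1 _ AT3]] := necessity AQ.
suff AT1_0 : cond_T1 J A 0 by split=> //; exact: T2_necessary.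
elim: k0 AT1 => // k IH AT1; apply: IH; apply: T1_lower_column AT1 => //.
by move=> x; exact: (T2_necessary (k0 := k.+1) AQ).
Qed.
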